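(* The harmonic measures $\nu_{\mathrm h}$ and $\nu_+$ are well defined, in the sense that the horizontal positions of simple random walk on $\Gamma_\circ$ started at $\varnothing$ converge almost surely to an element of $[0,1)\cong\mathbb{R}/\mathbb{Z}$, and the horizontal positions of simple random walk on $\Gamma_+$ started at $(0,\varnothing)$ converge almost surely to an element of $\mathbb{R}$. Furthermore, the support of $\nu_{\mathrm h}$ is $\mathbb{R}/\mathbb{Z}$, and for every path $(\varnothing,x_1,x_2,\ldots,x_k)$ in $\Gamma_\circ$ and every $\epsilon>0$, the probability is positive that the simple random walk $(X_n)_{n\ge0}$ on $\Gamma_\circ$ with $X_0=\varnothing$ has $X_1=x_1,\ldots,X_k=x_k$ and has the property that for all $n\ge k$, the horizontal position of $X_n$ differs from the horizontal position of $X_k$ (in $\mathbb{R}/\mathbb{Z}$) by less than $\epsilon$.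
   Context: For a finite binary string $w=w_1\dots w_n$, its depth is its length $n$ and its horizontal position is $\sum_{j=1}^n w_j2^{-j}\in[0,1)\cong\mathbb{R}/\mathbb{Z}$; the empty string $\varnothing$ has depth $0$ and position $0$. For strings of length $n$, addition of $\pm1$ is modulo $2^n$ (last digit is the units digit), and $w\oplus 0$ denotes appending $0$. $\Gamma_{\circ}$ is the (multi)graph on all finite binary strings with edges between $w$ and $w\pm1$ and between $w$ and $w\oplus 0$. At depth $1$ the vertices $0$ and $1$ are joined by two edges, and $\varnothing$ has two loops, each contributing $1$ to its degree. Thus simple random walk on $\Gamma_\circ$ picks uniformly from: add $1$; subtract $1$; append $0$; and, if the string ends in $0$, remove that terminal $0$ (from $\varnothing$: stay put in either of two ways, or append $0$). $\Gamma_+$ is the unwrapped version of $\Gamma_\circ$, of which $\Gamma_\circ$ is the quotient by horizontal integer translations: its vertices are pairs $(n,w)$ with $n\in\mathbb{Z}$ and $w$ a finite binary string; the horizontal position of $(n,w)$ is $n+x\in\mathbb{R}$, where $x$ is the horizontal position of $w$, and its depth is that of $w$. Thus vertices at depth $m\ge0$ correspond bijectively to positions in $2^{-m}\mathbb{Z}$; the vertex at depth $m$ and position $y$ is adjacent to the vertices at depth $m$ and positions $y\pm2^{-m}$, to the vertex at depth $m+1$ and position $y$, and, if $m\ge1$ and $y\in2^{-(m-1)}\mathbb{Z}$, to the vertex at depth $m-1$ and position $y$. The harmonic measure $\nu_{\mathrm h}$ is the law on $[0,1)\cong\mathbb{R}/\mathbb{Z}$ of the limit of the horizontal positions of simple random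 walk on $\Gamma_\circ$ started at $\varnothing$. The harmonic measure $\nu_+$ is the law on $\mathbb{R}$ of the limit of the horizontal positions of simple random walk on $\Gamma_+$ started at $(0,\varnothing)$. *)

(* Defs.v *)
From mathcomp Require Export all_boot all_order all_algebra.
From mathcomp Require Export all_classical all_reals all_analysis.

Set Implicit Arguments.
Unset Strict Implicit.
Unset Printing Implicit Defensive.

Export Order.TTheory GRing.Theory Num.Theory.
Export numFieldNormedType.Exports.

Local Open Scope classical_set_scope.
Local Open Scope ring_scope.

(* A binary string is w : seq bool, most significant digit first, so that
   nth false w j is the digit w_{j+1} of the 1-based convention. *)
Definition string := seq bool.

Definition string_val (w : string) : nat :=
  (\sum_(j < size w) nth false w j * 2 ^ (size w - j.+1))%N.

Definition string_of (n k : nat) : string :=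
  mkseq (fun j => odd (k %/ 2 ^ (n - j.+1))) n.

Definition string_add (z : int) (w : string) : string :=
  string_of (size w)
    (absz (((string_val w)%:Z + z) %% (2 ^ size w)%N%:Z)%Z).

(* The quotient (rounded towards -oo) of the addition performed by string_add. *)
Definition string_carry (z : int) (w : string) : int :=
  (((string_val w)%:Z + z) %/ (2 ^ size w)%N%:Z)%Z.

(* last true [::] = true, so the empty string does not end in 0. *)
Definition string_parent (w : string) : seq string :=
  if last true w then [::] else [:: take (size w).-1 w].

(* A locally finite multigraph is given by the list of neighbours of each
   vertex, a neighbour being repeated once per edge. *)
Definition nbr_circ (w : string) : seq string :=
  [:: string_add 1 w; string_add (- 1) w; rcons w false] ++ string_parent w.

Definition nbr_plus (v : int * string) : seq (int * string) :=
  [:: (v.1 + string_carry 1 v.2, string_add 1 v.2);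
      (v.1 + string_carry (- 1) v.2, string_add (- 1) v.2);
      (v.1, rcons v.2 false)]
  ++ [seq (v.1, w) | w <- string_parent v.2].

Definition adjacent (V : eqType) (nbr : V -> seq V) : rel V :=
  fun x y => y \in nbr x.

Definition pos_circ (R : realType) (w : string) : R :=
  \sum_(j < size w) (nth false w j)%:R / 2 ^+ j.+1.

Definition pos_plus (R : realType) (v : int * string) : R :=
  v.1%:~R + pos_circ R v.2.

(* R/Z is represented by [0,1), with the quotient metric of R. *)
Definition circle (R : realType) : set R := [set x | 0 <= x < 1].
Arguments circle R : clear implicits.

Definition circle_dist (R : realType) (x y : R) : R :=
  inf [set `|x - y + k%:~R| | k in [set: int]].

Definition circle_support (R : realType) (nu : set R -> \bar R) : set R :=
  [set x | circle R x /\
     forall eps : R, 0 < eps ->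
       (0 < nu (circle R `&` [set y | (circle_dist x y < eps)%R]))%E].

Definition srw_step (R : realType) (V : eqType) (nbr : V -> seq V)
    (x y : V) : R :=
  (count_mem y (nbr x))%:R / (size (nbr x))%:R.

Definition cylinder (T V : Type) (X : nat -> T -> V) (n : nat) (x : nat -> V)
    : set T :=
  [set t | forall i, (i <= n)%N -> X i t = x i].

Definition is_srw (R : realType) (V : eqType) (nbr : V -> seq V) (x0 : V)
    (d : measure_display) (T : measurableType d) (P : probability T R)
    (X : nat -> T -> V) : Prop :=
  [/\ forall n v, measurable [set t | X n t = v],
      P [set t | X 0%N t = x0] = 1%E
    & forall n (x : nat -> V),
        P (cylinder X n.+1 x) =
        (P (cylinder X n x) * (srw_step R nbr (x n) (x n.+1))%:E)%E].

Definition circ_limit (R : realType) (d : measure_display)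
    (T : measurableType d) (P : probability T R) (X : nat -> T -> string)
    (L : {RV P >-> R}) : Prop :=
  (forall t, circle R (L t)) /\
  {ae P, forall t, circle_dist (pos_circ R (X n t)) (L t) @[n --> \oo] --> (0 : R)}.

Definition plus_limit (R : realType) (d : measure_display)
    (T : measurableType d) (P : probability T R)
    (Y : nat -> T -> int * string) (L : {RV P >-> R}) : Prop :=
  {ae P, forall t, pos_plus R (Y n t) @[n --> \oo] --> (L t : R)}.

Definition is_harmonic_circ (R : realType) (nu : set R -> \bar R) : Prop :=
  exists (d : measure_display) (T : measurableType d) (P : probability T R)
         (X : nat -> T -> string) (L : {RV P >-> R}),
    [/\ is_srw nbr_circ [::] P X, circ_limit X L & nu = distribution P L].

(* Main.v *)
From mathcomp Require Import measurable_realfun zify ring lra.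
Require Import Defs.

(* A horizontal step at depth [m] has length [2 ^- m], so it suffices that the
   sum of [2 ^- depth] along the walk is almost surely finite.  The function
   [potential w], equal to [(3/4) ^+ size w] up to a factor 14 or 15 depending
   on the last digit of [w], dominates the step length and is contracted by the
   factor 79/80 by the transition operator of either graph.  Hence, conditionally
   on the first [n] steps, the remaining total horizontal variation has
   expectation at most [80 * potential (X n)].  This gives almost sure
   convergence.  It also shows, by Markov's inequality, that after appending
   enough zeros (which does not change the position) the walk stays
   [eps]-close forever with positive probability.  The circle-valued walk is
   lifted to the real line by taking the shortest representative of each
   increment. *)

Set Implicit Arguments.
Unset Strict Implicit.
Unset Printing Implicit Defensive.

Local Open Scope classical_set_scope.
Local Open Scope ring_scope.

(** * Measurability of countably valued maps and of cylinders *)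

Lemma measurable_preimage_discrete (d : measure_display) (T : measurableType d)
    (V : countType) (X : T -> V) :
  (forall v, measurable [set t | X t = v]) ->
  forall B : set V, measurable (X @^-1` B).
Proof.
move=> mX B.
have -> : X @^-1` B = \bigcup_v (if `[< B v >] then [set t | X t = v] else set0).
  apply/seteqP; split => [t Bt|t [v _]] /=.
    by exists (X t) => //=; case: asboolP.
  by case: asboolP => // Bv /= ->.
apply: countable_bigcupT_measurable; first exact: countableP.
by move=> v; case: ifP.
Qed.

Lemma measurable_fun_discrete (d d' : measure_display) (T : measurableType d)
    (T' : measurableType d') (V : countType) (X : T -> V) (f : V -> T')
    (D : set T) :
  (forall v, measurable [set t | X t = v]) ->
  measurable_fun D (fun t => f (X t)).
Proof.
move=> mX mD Y mY; apply: measurableI => //.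
exact: (measurable_preimage_discrete (mX) (f @^-1` Y)).
Qed.

Lemma measurable_discrete_pair (d : measure_display) (T : measurableType d)
    (V W : countType) (X : T -> V) (Y : T -> W) :
  (forall v, measurable [set t | X t = v]) ->
  (forall w, measurable [set t | Y t = w]) ->
  forall u, measurable [set t | (X t, Y t) = u].
Proof.
move=> mX mY [v w].
have -> : [set t | (X t, Y t) = (v, w)] = [set t | X t = v] `&` [set t | Y t = w].
  by apply/seteqP; split => t /= [-> ->].
exact: measurableI.
Qed.

Lemma cylinder0 (T V : Type) (X : nat -> T -> V) (x : nat -> V) :
  cylinder X 0 x = [set t | X 0%N t = x 0%N].
Proof.
apply/seteqP; split => t /=; first by move/(_ 0%N (leqnn _)).
by move=> H [].
Qed.

Lemma cylinderS (T V : Type) (X : nat -> T -> V) n (x : nat -> V) :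
  cylinder X n.+1 x = cylinder X n x `&` [set t | X n.+1 t = x n.+1].
Proof.
apply/seteqP; split => t /= => [H|[H H1] i].
  by split => [i iN|]; apply: H => //; rewrite ltnW.
by rewrite leq_eqVlt => /predU1P[->//|]; apply: H.
Qed.

Lemma eq_cylinder (T V : Type) (X : nat -> T -> V) n (x y : nat -> V) :
  (forall i, (i <= n)%N -> x i = y i) -> cylinder X n x = cylinder X n y.
Proof. by move=> xy; apply/seteqP; split => t /= H i iN; rewrite H ?xy. Qed.

Lemma measurable_cylinder (d : measure_display) (T : measurableType d)
    (V : Type) (X : nat -> T -> V) :
  (forall n v, measurable [set t | X n t = v]) ->
  forall n x, measurable (cylinder X n x).
Proof.
move=> mX; elim=> [|n IH] x; first by rewrite cylinder0.
by rewrite cylinderS; apply: measurableI.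
Qed.

(** [cylinder] takes an infinite sequence of which only the first terms matter; [update] prescribes
    the next vertex, so that a cylinder can be refined by one step. *)
Definition update (V : Type) (x : nat -> V) n v : nat -> V :=
  fun i => if i == n then v else x i.

Lemma cylinderS_update (T V : Type) (X : nat -> T -> V) n (x : nat -> V) v :
  cylinder X n.+1 (update x n.+1 v) = cylinder X n x `&` [set t | X n.+1 t = v].
Proof.
rewrite cylinderS /update eqxx; congr (_ `&` _); apply: eq_cylinder => i iN.
by case: eqP => // E; rewrite E ltnn in iN.
Qed.

(** * Conditioning on one step of the walk *)

(** Parallel edges are repeated entries of [nbr v]: weighting each distinct neighbour by its
    multiplicity gives the average over the list. *)
Lemma sum_srw_step (R : realType) (V : eqType) (nbr : V -> seq V) (g : V -> R) v :
  \sum_(y <- undup (nbr v)) g y * srw_step R nbr v y =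
  (\sum_(y <- nbr v) g y) / (size (nbr v))%:R.
Proof.
rewrite mulr_suml -(big_undup_iterop_count _ (nbr v)) /=.
apply: eq_bigr => y _.
by rewrite -[RHS]/((_ / _) *+ count_mem y (nbr v)) -mulr_natl /srw_step mulrCA.
Qed.

Lemma is_srw_cylinder_step (R : realType) (V : countType) (nbr : V -> seq V)
    (x0 : V) (d : measure_display) (T : measurableType d)
    (P : probability T R) (X : nat -> T -> V) :
  is_srw nbr x0 P X -> forall n x v,
  P (cylinder X n.+1 (update x n.+1 v)) =
    (P (cylinder X n x) * (srw_step R nbr (x n) v)%:E)%E.
Proof.
move=> [_ _ H] n x v; rewrite H /update eqxx.
have nn i : (i <= n)%N -> (i == n.+1) = false.
  by move=> iN; apply/eqP => E; rewrite E ltnn in iN.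
by rewrite nn //; congr (P _ * _)%E; apply: eq_cylinder => i iN; rewrite nn.
Qed.

(** The refined cylinders are disjoint, and they exhaust [cylinder X n x] up to a null set because
    the transition probabilities to the neighbours add up to 1. *)
Lemma srw_integral_split (R : realType) (V : countType) (nbr : V -> seq V)
    (x0 : V) (d : measure_display) (T : measurableType d)
    (P : probability T R) (X : nat -> T -> V) :
  is_srw nbr x0 P X -> (forall v, (0 < size (nbr v))%N) ->
  forall (f : T -> \bar R) n x, measurable_fun [set: T] f ->
  (forall t, 0 <= f t)%E ->
  (\int[P]_(t in cylinder X n x) f t =
   \sum_(v <- undup (nbr (x n)))
     \int[P]_(t in cylinder X n.+1 (update x n.+1 v)) f t)%E.
Proof.
move=> srwX nbr0 f n x mf f0; have [mX _ _] := srwX.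
set s := undup _; set A := cylinder X n x.
pose C v := cylinder X n.+1 (update x n.+1 v).
have mA : measurable A by exact: measurable_cylinder.
have mC v : measurable (C v) by exact: measurable_cylinder.
have CA v : C v `<=` A by rewrite /C cylinderS_update => t [].
have tC : trivIset [set` s] C.
  move=> u v _ _ [t []]; rewrite /C !cylinderS_update => -[_ /= ->] [_ /= ->] //.
set B := \big[setU/set0]_(v <- s) C v.
have mB : measurable B by apply: bigsetU_measurable.
have BA : B `<=` A.
  by rewrite /B; elim/big_ind : _ => // U W UA WA t [/UA|/WA].
have mCs (h : T -> \bar R) : measurable_fun [set: T] h ->
    forall D, d.-measurable D -> measurable_fun D h.
  by move=> mh D mD; apply: measurable_funS mh.
have PB : P B = P A.
  rewrite -[P B]mul1e -integral_cst // (ge0_integral_bigsetU P) //;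
    last exact: undup_uniq.
  transitivity (\sum_(v <- s) (P A * (srw_step R nbr (x n) v)%:E))%E.
    apply: eq_bigr => v _; rewrite integral_cst // mul1e.
    exact: (is_srw_cylinder_step srwX).
  rewrite -ge0_sume_distrr; last by move=> v _; rewrite lee_fin divr_ge0.
  rewrite sumEFin (_ : \sum_(_ <- _) _ = 1) ?mule1 //.
  under eq_bigr do rewrite -[srw_step _ _ _ _]mul1r.
  rewrite (sum_srw_step nbr (fun=> 1)) big_const_seq count_predT iter_addr_0.
  by rewrite divff // pnatr_eq0 -lt0n.
have PAB : P (A `\` B) = 0%E.
  rewrite measureD //= ?(setIidr BA) ?PB ?subee ?fin_num_measure //.
  by rewrite ltey_eq fin_num_measure.
rewrite -(ge0_integral_bigsetU P) //; [|exact: undup_uniq|exact: mCs].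
have mAB := measurableD mA mB.
rewrite -/B -[in LHS](setDUK BA) ge0_integral_setU //.
- by rewrite (null_set_integral mAB _ PAB) ?adde0 //; exact: mCs.
- by apply: mCs => //; exact: measurableU.
- by rewrite disj_set2E setDIK.
Qed.

(* Induction on [k], splitting the cylinder according to the next vertex: no
   Markov property beyond the definition of [is_srw] is needed. *)
Lemma srw_increment_integral (R : realType) (V : countType) (nbr : V -> seq V)
    (x0 : V) (d : measure_display) (T : measurableType d)
    (P : probability T R) (X : nat -> T -> V)
    (g : V -> R) (rho : R) (D : V -> V -> R) :
  is_srw nbr x0 P X -> (forall v, (0 < size (nbr v))%N) -> 0 <= rho ->
  (forall v, \sum_(y <- nbr v) g y <= rho * g v * (size (nbr v))%:R) ->
  (forall u v, 0 <= D u v) -> (forall u v, v \in nbr u -> D u v <= g u) ->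
  forall k n x,
  (\int[P]_(t in cylinder X n x) (D (X (n + k)%N t) (X (n + k).+1 t))%:E
     <= (rho ^+ k * g (x n))%:E * P (cylinder X n x))%E.
Proof.
move=> srwX nbr0 rho0 superg D0 Dg; have [mX _ _] := srwX.
have mpair m : measurable_fun [set: T] (fun t => (D (X m t) (X m.+1 t))%:E).
  apply: (measurable_fun_discrete
    (X := fun t => (X m t, X m.+1 t)) (fun u => (D u.1 u.2)%:E)).
  exact: measurable_discrete_pair.
have mA n x : measurable (cylinder X n x) by exact: measurable_cylinder.
have fP n x : P (cylinder X n x) = (fine (P (cylinder X n x)))%:E.
  by rewrite fineK // fin_num_measure.
have nbrR n : (0 : R) < (size (nbr n))%:R by rewrite ltr0n.
have PC n x v : P (cylinder X n.+1 (update x n.+1 v)) =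
    (fine (P (cylinder X n x)) * srw_step R nbr (x n) v)%:E.
  by rewrite (is_srw_cylinder_step srwX) fP EFinM.
have step0 u v : 0 <= srw_step R nbr u v by rewrite divr_ge0.
have p0 n x : 0 <= fine (P (cylinder X n x)) by rewrite fine_ge0.
elim=> [|k IH] n x;
  (rewrite (srw_integral_split srwX) //; last by move=> t; rewrite lee_fin);
  rewrite fP; set p := fine _.
- rewrite addn0 expr0 mul1r.
  apply: (@le_trans _ _
    (\sum_(v <- undup (nbr (x n))) (g (x n) * (p * srw_step R nbr (x n) v))%:E)%E).
    rewrite big_seq [in leRHS]big_seq; apply: lee_sum => v.
    rewrite mem_undup => vx.
    (* On the refined cylinder both endpoints of the step are fixed, so the integrand is
       constant. *)
    rewrite (_ : (\int[P]_(t in _) _)%E =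
      (\int[P]_(t in cylinder X n.+1 (update x n.+1 v)) (D (x n) v)%:E)%E).
      rewrite integral_cst // EFinM -PC; apply: lee_wpmul2r => //.
      by rewrite lee_fin Dg.
    apply: eq_integral => t.
    by rewrite inE cylinderS_update => -[/(_ n (leqnn n)) -> ->].
  rewrite sumEFin -EFinM lee_fin -mulr_sumr -mulr_sumr.
  under eq_bigr do rewrite -[srw_step _ _ _ _]mul1r.
  rewrite (sum_srw_step nbr (fun=> 1)) big_const_seq count_predT iter_addr_0.
  by rewrite divff ?mulr1 // gt_eqF.
(* The induction hypothesis at time [n.+1] bounds each summand; averaging [g] over the neighbours
   then yields the additional factor [rho]. *)
- apply: (@le_trans _ _
    (\sum_(v <- undup (nbr (x n))) ((rho ^+ k * p) *
      (g v * srw_step R nbr (x n) v))%:E)%E).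
    apply: lee_sum => v _; have := IH n.+1 (update x n.+1 v).
    rewrite PC /update eqxx addSnnS -EFinM => /le_trans; apply.
    by rewrite lee_fin mulrACA.
  rewrite sumEFin -EFinM lee_fin -mulr_sumr sum_srw_step exprSr.
  rewrite -!mulrA; apply: ler_wpM2l; first exact: exprn_ge0.
  rewrite [g _ * p]mulrC [leRHS]mulrCA; apply: ler_wpM2l; first exact: p0.
  by rewrite ler_pdivrMr.
Qed.

(** * Finite variation of a walk whose steps are dominated by a contracted function *)

Section transience.
Variables (R : realType) (V : countType) (nbr : V -> seq V) (x0 : V).
Variables (d : measure_display) (T : measurableType d).
Variables (P : probability T R) (X : nat -> T -> V).
Variables (g : V -> R) (rho : R) (D : V -> V -> R).
Hypothesis srwX : is_srw nbr x0 P X.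
Hypothesis nbr_gt0 : forall v, (0 < size (nbr v))%N.
Hypotheses (rho_ge0 : 0 <= rho) (rho_lt1 : rho < 1).
Hypothesis superharmonic :
  forall v, \sum_(y <- nbr v) g y <= rho * g v * (size (nbr v))%:R.
Hypothesis D_le : forall u v, v \in nbr u -> `|D u v| <= g u.

(** The total length of all steps from time [n] on, taken in the extended reals so that it is
    defined on every trajectory. *)
Definition variation n t : \bar R :=
  (\sum_(0 <= k <oo) `|D (X (n + k) t) (X (n + k).+1 t)|%:E)%E.

Let mstep n k : measurable_fun [set: T]
  (fun t => `|D (X (n + k)%N t) (X (n + k).+1 t)|%:E).
Proof.
have [mX _ _] := srwX.
apply: (measurable_fun_discrete
  (X := fun t => (X (n + k)%N t, X (n + k).+1 t)) (fun u => `|D u.1 u.2|%:E)).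
exact: measurable_discrete_pair.
Qed.

Lemma measurable_variation n : measurable_fun [set: T] (variation n).
Proof.
have H (k : nat) t : setT t -> xpredT k ->
    (0 <= `|D (X (n + k) t) (X (n + k).+1 t)|%:E)%E by rewrite lee_fin.
exact: (ge0_emeasurable_sum H (fun k _ => mstep n k)).
Qed.

Lemma variation_ge0 n t : (0 <= variation n t)%E.
Proof. by apply: nneseries_ge0 => k _ _; rewrite lee_fin. Qed.

Lemma le_variation n t m :
  ((\sum_(0 <= k < m) `|D (X (n + k) t) (X (n + k).+1 t)|)%:E <= variation n t)%E.
Proof.
rewrite -sumEFin; apply: nneseries_lim_ge => k _ _; by rewrite lee_fin.
Qed.

Let mA n x : measurable (cylinder X n x).
Proof. by have [mX _ _] := srwX; exact: measurable_cylinder. Qed.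

(** Every vertex has a neighbour, and [g] dominates the absolute value of the step to it. *)
Let g_ge0 v : 0 <= g v.
Proof.
have := nbr_gt0 v; case E : (nbr v) => [//|y s] _.
by apply: le_trans (@D_le v y _) => //; rewrite E mem_head.
Qed.

(** Integrating term by term, the [k]-th step contributes at most [rho ^+ k * g (x n)] times the
    probability of the cylinder; the geometric series is then summed. *)
Lemma variation_integral n x :
  (\int[P]_(t in cylinder X n x) variation n t
     <= (g (x n) / (1 - rho))%:E * P (cylinder X n x))%E.
Proof.
rewrite integral_nneseries //; last first.
  by move=> k; apply: measurable_funS (mstep n k).
set p := P _; have fp : p = (fine p)%:E by rewrite fineK // fin_num_measure.
have p0 : 0 <= fine p by rewrite fine_ge0 ?measure_ge0.
apply: lime_le.
  apply: is_cvg_nneseries => k _ _; apply: integral_ge0 => t _.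
  by rewrite lee_fin.
near=> m.
apply: (@le_trans _ _ (\sum_(0 <= k < m) (rho ^+ k * g (x n))%:E * p)%E).
  apply: lee_sum => k _.
  apply: (srw_increment_integral (D := fun u v => `|D u v|) srwX) => //.
rewrite fp; under eq_bigr do rewrite -EFinM.
rewrite sumEFin -EFinM lee_fin -mulr_suml; apply: ler_wpM2r => //.
rewrite -mulr_suml mulrC; apply: ler_wpM2l => //.
have -> : \sum_(0 <= i < m) rho ^+ i = (1 - rho ^+ m) / (1 - rho).
  have := @geometric_seriesE _ 1 rho (negbT (lt_eqF rho_lt1)).
  move/(congr1 (fun f => f m)); rewrite /series /= mul1r => <-.
  by apply: eq_bigr => i _; rewrite mul1r.
rewrite ler_pdivrMr ?subr_gt0 // mulVf ?subr_eq0 ?(gt_eqF rho_lt1) //.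
by rewrite gerBl exprn_ge0.
Unshelve. all: by end_near. Qed.

(** The cylinder of length 0 at [x0] has full measure, and a function integrable on it is finite
    almost everywhere. *)
Lemma ae_variation_fin : {ae P, forall t, variation 0 t \is a fin_num}.
Proof.
have [mX PX0 _] := srwX.
have cyl0 : cylinder X 0 (fun=> x0) = [set t | X 0%N t = x0] by rewrite cylinder0.
have PA : P (cylinder X 0 (fun=> x0)) = 1%E by rewrite cyl0.
have := @variation_integral 0 (fun=> x0); rewrite PA mule1 => intA.
have : {ae P, forall t, cylinder X 0 (fun=> x0) t}.
  exists (~` cylinder X 0 (fun=> x0)); split => //; first exact: measurableC.
  by rewrite probability_setC // PA subee.
have : P.-integrable (cylinder X 0 (fun=> x0)) (variation 0).
  apply/integrableP; split.
    exact: measurable_funS (measurable_variation 0).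
  under eq_integral do rewrite gee0_abs ?variation_ge0 //.
  by apply: (le_lt_trans intA); rewrite ltry.
move/(integrable_ae (mA _ _)).
by apply: filterS2 => t; apply.
Qed.

Lemma ae_increments_cvg :
  {ae P, forall t, cvgn (series (fun k => D (X k t) (X k.+1 t)))}.
Proof.
apply: filterS ae_variation_fin => t Wfin.
apply: normed_cvg; apply: nondecreasing_is_cvgn.
  by apply: nondecreasing_series => k _ _ /=.
exists (fine (variation 0 t)) => _ [m _ <-].
by rewrite -lee_fin fineK //; exact: le_variation.
Qed.

Lemma srw_limit (f : V -> R) : exists L : {RV P >-> R},
  {ae P, forall t, f (X 0%N t) + \sum_(0 <= k < n) D (X k t) (X k.+1 t)
    @[n --> \oo] --> (L t : R)}.
Proof.
have [mX _ _] := srwX.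
pose S n t := f (X 0%N t) + \sum_(0 <= k < n) D (X k t) (X k.+1 t).
have mS n : measurable_fun [set: T] (fun t => (S n t)%:E).
  apply/measurable_EFinP; apply: measurable_funD.
    exact: (measurable_fun_discrete _ (mX 0%N)).
  apply: measurable_sum => k.
  apply: (measurable_fun_discrete
    (X := fun t => (X k t, X k.+1 t)) (fun u => D u.1 u.2)).
  exact: measurable_discrete_pair.
(* The upper limit is measurable and defined on every trajectory; it equals the limit wherever the
   series converges, which is almost everywhere. *)
pose L t := fine (limn_esup (fun n => (S n t)%:E)).
have mL : measurable_fun [set: T] L.
  apply: (@measurableT_comp _ _ _ _ _ _ fine) => //.
  exact: measurable_fun_limn_esup.
exists (mfun_Sub (mem_set mL)).
apply: filterS ae_increments_cvg => t cvD.
have cS : S n t @[n --> \oo] -->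
    f (X 0%N t) + limn (series (fun k => D (X k t) (X k.+1 t))).
  by apply: cvgD; [exact: cvg_cst|exact: cvD].
have cE : (S n t)%:E @[n --> \oo] --> (lim (S n t @[n --> \oo]))%:E.
  by apply: cvg_EFin; [exact: nearW|apply: cvgP cS].
by rewrite /= /L (cvg_limn_einf_sup cE) /=; exact: cvgP cS.
Qed.

Lemma srw_small_variation n x (eps : R) :
  (0 < P (cylinder X n x))%E -> g (x n) / (1 - rho) < eps ->
  (0 < P (cylinder X n x `&` [set t | variation n t < eps%:E]))%E.
Proof.
move=> PA ge.
set A := cylinder X n x in PA *; set B := A `&` _.
pose C := A `&` [set t | (eps%:E <= variation n t)%E].
have mlt : measurable [set t | (variation n t < eps%:E)%E].
  rewrite -[X in measurable X]setTI; apply: emeasurable_fun_infty_o => //.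
  exact: measurable_variation.
have AC : A `\` B = C.
  apply/seteqP; split => t /=.
    by move=> [At nB]; split => //=; rewrite leNgt; apply/negP => lt; apply: nB.
  by move=> [At] /= le; split => // -[_] /=; rewrite ltNge le.
have mB : measurable B by apply: measurableI => //; exact: mA.
have BA : B `<=` A by move=> t [].
have fA : P A \is a fin_num by rewrite fin_num_measure //; exact: mA.
(* Markov's inequality: [eps * P C] is at most the integral of the variation over [A], which is less
   than [eps * P A]. *)
have PC : (P C < P A)%E.
  have eps0 : 0 < eps.
    apply: le_lt_trans ge; apply: divr_ge0; first exact: g_ge0.
    by rewrite subr_ge0 ltW.
  have : (eps%:E * P C <= (g (x n) / (1 - rho))%:E * P A)%E.
    apply: le_trans (variation_integral n x).
    rewrite -/A [leRHS](eq_integral (fun t => `|variation n t|))%E; last first.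
      by move=> t _; rewrite gee0_abs ?variation_ge0.
    rewrite /C (_ : [set t | (eps%:E <= _)%E] =
      [set t | (eps%:E <= `|variation n t|)%E]).
      apply: le_integral_abse => //; first exact: mA.
      exact: measurable_funS (measurable_variation n).
    by apply/seteqP; split => t /=; rewrite gee0_abs ?variation_ge0.
  move=> /le_lt_trans H; rewrite -(@lte_pmul2l _ eps%:E) ?lte_fin //.
  by apply: H; rewrite lte_pmul2r.
rewrite lt0e measure_ge0 andbT; apply/eqP => PB.
have PAB : (P (A `\` B) = P A - P B)%E.
  rewrite -[in RHS](setIidr BA); apply: measureD => //; first exact: mA.
  by rewrite ltey_eq fA.
by move: PC; rewrite -AC PAB PB sube0 ltxx.
Qed.
End transience.

(** * Binary strings as integers, and the horizontal length of edges *)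

Lemma size_string_of n k : size (string_of n k) = n.
Proof. by rewrite size_mkseq. Qed.

Lemma string_val_of n k : string_val (string_of n k) = (k %% 2 ^ n)%N.
Proof.
(* Reversing the index gives digit [i] the weight [2 ^ i], which suits induction on [n]. *)
rewrite /string_val size_string_of (reindex_inj rev_ord_inj) /=.
rewrite (eq_bigr (fun i : 'I_n => odd (k %/ 2 ^ i) * 2 ^ i)%N); last first.
  move=> i _; rewrite nth_mkseq; last by have := ltn_ord i; lia.
  by rewrite (_ : n - (n - i.+1).+1 = i)%N //; have := ltn_ord i; lia.
elim: n => [|n IH]; first by rewrite big_ord0 modn1.
rewrite big_ord_recr /= IH expnS.
(* Splits off the most significant bit of the residue. *)
have -> : (k %% (2 * 2 ^ n) = k %/ 2 ^ n %% 2 * 2 ^ n + k %% 2 ^ n)%N.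
  have p0 : (0 < 2 ^ n)%N by rewrite expn_gt0.
  have {1}-> : k = (k %/ 2 ^ n %/ 2 * (2 * 2 ^ n) +
      (k %/ 2 ^ n %% 2 * 2 ^ n + k %% 2 ^ n))%N.
    by rewrite addnA mulnA -mulnDl -divn_eq -divn_eq.
  rewrite modnMDl modn_small //.
  have := ltn_pmod k p0; have := ltn_pmod (k %/ 2 ^ n) (isT : 0 < 2)%N; nia.
by rewrite modn2 addnC.
Qed.

Lemma last_string_of n k : (0 < n)%N -> last false (string_of n k) = odd k.
Proof.
move=> n0; rewrite -nth_last size_string_of nth_mkseq; last by lia.
by rewrite (_ : n - n.-1.+1 = 0)%N ?divn1 //; lia.
Qed.

(** All digits but the last have even weight. *)
Lemma odd_string_val w : odd (string_val w) = last false w.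
Proof.
case/lastP: w => [|w b]; first by rewrite /string_val big_ord0.
rewrite /string_val last_rcons size_rcons big_ord_recr /= nth_rcons ltnn eqxx.
rewrite subnn expn0 muln1 oddD oddb (_ : odd _ = false) //.
apply/negbTE; rewrite -dvdn2; apply: dvdn_sum => i _; apply: dvdn_mull.
by apply: dvdn_exp => //; have := ltn_ord i; lia.
Qed.

Lemma pos_circE (R : realType) w :
  pos_circ R w = (string_val w)%:R / 2 ^+ size w.
Proof.
rewrite /pos_circ /string_val natr_sum mulr_suml; apply: eq_bigr => j _.
rewrite natrM natrX -mulrA; congr (_ * _).
have -> : (2 : R) ^+ size w = 2 ^+ (size w - j.+1) * 2 ^+ j.+1.
  by rewrite -exprD subnK.
by rewrite invfM mulrA divff ?mul1r // expf_neq0.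
Qed.

Lemma pos_circ_rcons0 (R : realType) w : pos_circ R (rcons w false) = pos_circ R w.
Proof.
rewrite /pos_circ size_rcons big_ord_recr /= nth_rcons ltnn eqxx mul0r addr0.
by apply: eq_bigr => i _; rewrite nth_rcons ltn_ord.
Qed.

Lemma pos_circ_cat_nseq0 (R : realType) w m :
  pos_circ R (w ++ nseq m false) = pos_circ R w.
Proof.
by elim: m => [|m IH]; rewrite ?cats0 // -addn1 nseqD catA cats1 pos_circ_rcons0.
Qed.

Lemma string_parent_rcons w b :
  string_parent (rcons w b) = if b then [::] else [:: w].
Proof.
by rewrite /string_parent last_rcons size_rcons -cats1 take_size_cat.
Qed.

Lemma string_parentP w u : u \in string_parent w -> w = rcons u false.
Proof.
case/lastP: w => [|w b] //; rewrite string_parent_rcons.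
by case: b => //; rewrite inE => /eqP ->.
Qed.

Lemma size_string_add z w : size (string_add z w) = size w.
Proof. exact: size_string_of. Qed.

Lemma string_val_add z w :
  (string_val (string_add z w))%:Z = (string_val w)%:Z + z
    - string_carry z w * (2 ^ size w)%N%:Z.
Proof.
rewrite /string_add string_val_of /string_carry.
have : (0 < 2 ^ size w)%N by rewrite expn_gt0.
move: (2 ^ size w)%N (_ + z) => N x N0.
have m0 : 0 <= (x %% N%:Z)%Z by apply: modz_ge0; lia.
have mN : (x %% N%:Z)%Z < N%:Z by apply: ltz_pmod.
rewrite modn_small; last by lia.
by rewrite gez0_abs // [in RHS](divz_eq x N%:Z) addrC addrK.
Qed.

(** The carry restores what reduction modulo [2 ^ size w] removes, so on the real line the move is
    an exact translation. *)
Lemma pos_plus_add (R : realType) k z w :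
  pos_plus R (k + string_carry z w, string_add z w) =
  pos_plus R (k, w) + z%:~R / 2 ^+ size w.
Proof.
rewrite /pos_plus /= !pos_circE size_string_add.
have := congr1 (fun x : int => x%:~R : R) (string_val_add z w).
rewrite /= rmorphB rmorphD rmorphM /= -!pmulrn natrX => ->.
have : (2 : R) ^+ size w != 0 by rewrite expf_neq0.
by rewrite rmorphD /=; move: (2 ^+ size w) => N N0; field.
Qed.

Lemma nbr_plus_dist (R : realType) u v : v \in nbr_plus u ->
  `|pos_plus R v - pos_plus R u| <= 2^-1 ^+ size u.2.
Proof.
case: u => k w; rewrite mem_cat => /orP[|/mapP[w' /string_parentP /= -> ->]].
  have z1 z : `|z| = 1 ->
      `|pos_plus R (k + string_carry z w, string_add z w) - pos_plus R (k, w)|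
        <= 2^-1 ^+ size w.
    move=> z1; rewrite pos_plus_add addrAC subrr add0r normrM -intr_norm z1 mul1r.
    by rewrite ger0_norm ?exprVn // invr_ge0 exprn_ge0.
  rewrite !inE => /or3P[] /eqP -> /=; [exact: z1|exact: z1|].
  by rewrite /pos_plus /= pos_circ_rcons0 subrr normr0 exprn_ge0.
by rewrite /pos_plus /= pos_circ_rcons0 subrr normr0 exprn_ge0.
Qed.

(** The circular graph is the quotient of the unwrapped one, with edge multiplicities preserved.
    Estimates can thus be transferred between the two; the lift [k] is arbitrary. *)
Lemma nbr_circE k w : nbr_circ w = [seq v.2 | v <- nbr_plus (k, w)].
Proof. by rewrite /nbr_plus map_cat -map_comp /= map_id. Qed.

Lemma nbr_circ_dist (R : realType) u v : v \in nbr_circ u ->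
  exists k : int, `|pos_circ R v - pos_circ R u + k%:~R| <= 2^-1 ^+ size u.
Proof.
rewrite (nbr_circE 0) => /mapP[[k w] /(nbr_plus_dist R)] /= H ->.
(* With [u] lifted to level 0, the integer needed is the level of the lifted neighbour. *)
by exists k; move: H; rewrite /pos_plus /= add0r -addrA addrC.
Qed.

(** * The potential and its contraction *)

(* At strings ending in 0 the depth is a martingale; at strings ending in 1 it
   never decreases, which is why these get the lower weight 14. *)
Definition potential (R : realType) (w : string) : R :=
  (if last false w then 14 else 15) * (3 / 4) ^+ size w.

(** For a nonempty string the modulus is even, so adding an odd number flips the parity even after
    wrapping around. *)
Lemma last_string_add1 z w : `|z|%N = 1%N -> w != [::] ->
  last false (string_add z w) = ~~ last false w.
Proof.
move=> z1 w0; rewrite -!odd_string_val.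
have := string_val_add z w; case: w w0 => // b w _.
by rewrite /= expnS; lia.
Qed.

Lemma potential_superharmonic_circ (R : realType) w :
  \sum_(v <- nbr_circ w) potential R v <=
    79 / 80 * potential R w * (size (nbr_circ w))%:R.
Proof.
case/lastP: w => [|w b].
  (* The empty string has weight 15, since [last false [::]] is [false]; its two loops count as two
     neighbours. *)
  by rewrite /nbr_circ /string_add /= !big_cons big_nil /potential /=; lra.
have wb0 : rcons w b != [::] by case: w.
rewrite /nbr_circ string_parent_rcons big_cat !big_cons big_nil /potential.
rewrite !(last_string_add1 _ wb0) // !size_string_add !last_rcons !size_rcons.
have a0 : 0 <= (3 / 4 : R) ^+ size w by rewrite exprn_ge0 // divr_ge0.
rewrite !exprS; case: b wb0 => _; rewrite /= ?big_cons big_nil /=;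
  move: (_ ^+ size w) a0 => a a0; first by lra.
(* Split on the last digit of the parent. A parent of weight 15 is the extremal case, which fixes
   the constant: 28 + 45/4 + 20 = (79/80) * 60. *)
by case: last; lra.
Qed.

Lemma potential_superharmonic_plus (R : realType) (v : int * string) :
  \sum_(u <- nbr_plus v) potential R u.2 <=
    79 / 80 * potential R v.2 * (size (nbr_plus v))%:R.
Proof.
case: v => k w; have := potential_superharmonic_circ R w.
by rewrite (nbr_circE k) big_map size_map.
Qed.

Lemma potential_le (R : realType) w : potential R w <= 15 * (3 / 4) ^+ size w.
Proof.
have a0 : 0 <= (3 / 4 : R) ^+ size w by rewrite exprn_ge0 // divr_ge0.
by rewrite /potential ler_wpM2r //; case: ifP => _; lra.
Qed.

Lemma potential_ge (R : realType) w : 2^-1 ^+ size w <= potential R w.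
Proof.
have : (2^-1 : R) ^+ size w <= (3 / 4) ^+ size w.
  by apply: lerXn2r; rewrite ?nnegrE //; lra.
have : 0 <= (3 / 4 : R) ^+ size w by rewrite exprn_ge0 // divr_ge0.
by rewrite /potential; case: ifP => _; lra.
Qed.

(** * Lifting circle increments, and the metric of the circle *)

(** The representative in [-1/2, 1/2) of the increment modulo 1. *)
Definition circle_step (R : realType) (u v : string) : R :=
  let r := pos_circ R v - pos_circ R u in r - (Num.floor (r + 2^-1))%:~R.

(** The chosen representative has absolute value at most 1/2, and any other one differs from it by
    at least 1. *)
Lemma dist_nearest_int (R : realType) (r : R) (k : int) :
  `|r - (Num.floor (r + 2^-1))%:~R| <= `|r + k%:~R|.
Proof.
have /andP[] := floor_itv (r + 2^-1).
rewrite intrD; set m := Num.floor _ => lo hi.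
case: (eqVneq m (- k)) => [->|mk]; first by rewrite rmorphN opprK.
have : 1 <= `|m%:~R + k%:~R : R|.
  by rewrite -intrD -intr_norm -[leLHS]/(1%:~R) ler_int; lia.
have -> : m%:~R + k%:~R = r + k%:~R - (r - m%:~R) :> R by ring.
move=> /le_trans/(_ (ler_normB _ _)).
have : `|r - m%:~R| <= 2^-1 by rewrite ler_norml; apply/andP; split; lra.
by lra.
Qed.

Lemma circle_step_le (R : realType) u v : v \in nbr_circ u ->
  `|circle_step R u v| <= potential R u.
Proof.
move=> /(nbr_circ_dist R)[k kle]; apply: le_trans (potential_ge R u).
by apply: le_trans kle; exact: dist_nearest_int.
Qed.

(** Trades the infimum for an explicit integer translate, the form in which circle distances are
    estimated below. *)
Lemma circle_dist_ltP (R : realType) (x y e : R) :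
  circle_dist x y < e <-> exists k : int, `|x - y + k%:~R| < e.
Proof.
have hi : has_inf [set `|x - y + k%:~R| | k in [set: int]].
  split; first by exists `|x - y + 0%:~R|, 0.
  by exists 0 => _ [k _ <-].
split=> [lt|[k]]; last first.
  by apply: le_lt_trans; apply: ge_inf; [case: hi|exists k].
have d0 : 0 < e - circle_dist x y by rewrite subr_gt0.
have [_ [k _ <-]] := inf_adherent d0 hi.
by rewrite -/(circle_dist x y) [ltRHS]addrC subrK; exists k.
Qed.

Lemma circle_dist_ge0 (R : realType) (x y : R) : 0 <= circle_dist x y.
Proof.
rewrite leNgt; apply/negP => /circle_dist_ltP[k].
by rewrite ltNge normr_ge0.
Qed.

Lemma circle_dist_le (R : realType) (x y : R) (k : int) :
  circle_dist x y <= `|x - y + k%:~R|.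
Proof.
rewrite leNgt; apply/negP => lt.
suff: circle_dist x y < circle_dist x y by rewrite ltxx.
by apply/circle_dist_ltP; exists k.
Qed.

Lemma measurable_circle_ball (R : realType) (x e : R) :
  measurable [set y | circle_dist x y < e].
Proof.
have -> : [set y | circle_dist x y < e] =
    \bigcup_(k : int) [set y | `|x - y + k%:~R| < e].
  apply/seteqP; split => y /=.
    by move/circle_dist_ltP => [k ke]; exists k.
  by move=> [k _ ke]; apply/circle_dist_ltP; exists k.
apply: countable_bigcupT_measurable => [|k]; first exact: countableP.
rewrite -[X in measurable X]setTI.
have mf : measurable_fun [set: R] (fun y => `|x - y + k%:~R|).
  apply: measurableT_comp => //; apply: measurable_funD => //.
  exact: measurable_funB.
by have := mf measurableT _ (measurable_itv `]-oo, e[).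
Qed.

Lemma measurable_circle (R : realType) : measurable (circle R).
Proof. exact: (measurable_itv `[0, 1[). Qed.

Lemma measurable_frac (R : realType) :
  measurable_fun [set: R] (fun x => x - (Num.floor x)%:~R).
Proof.
move=> _ Y mY; rewrite setTI.
(* On each interval [k, k+1) the fractional part is the translation by -k. *)
have -> : (fun x : R => x - (Num.floor x)%:~R) @^-1` Y =
    \bigcup_(k : int) ([set` `[k%:~R, (k + 1)%:~R[] `&` (fun x => x - k%:~R) @^-1` Y).
  apply/seteqP; split => x /=.
    by move=> Yx; exists (Num.floor x) => //; split => //=; rewrite in_itv /= floor_itv.
  move=> [k _ [/=]]; rewrite in_itv /= => kx.
  by rewrite (floor_def kx).
apply: countable_bigcupT_measurable => [|k]; first exact: countableP.
apply: measurableI; first exact: measurable_itv.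
have mf : measurable_fun [set: R] (fun x : R => x - k%:~R) by exact: measurable_funB.
by rewrite -[X in measurable X]setTI; exact: mf.
Qed.

(** * Positive probability of following a path and then staying close *)

Lemma srw_cylinder_gt0 (R : realType) (V : countType) (nbr : V -> seq V)
    (x0 : V) (d : measure_display) (T : measurableType d)
    (P : probability T R) (X : nat -> T -> V) :
  is_srw nbr x0 P X -> forall n (x : nat -> V), x 0%N = x0 ->
  (forall i, (i < n)%N -> x i.+1 \in nbr (x i)) -> (0 < P (cylinder X n x))%E.
Proof.
move=> [_ PX0 PX]; elim=> [|n IH] x xE adj.
  by rewrite cylinder0 xE PX0.
rewrite PX mule_gt0 //; first by apply: IH => // i iN; apply: adj; exact: ltnW.
have := adj n (ltnSn n); rewrite lte_fin /srw_step => xn.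
rewrite divr_gt0 // ltr0n -?has_count ?has_pred1 //.
by case: (nbr _) xn.
Qed.

(** The sum of the shortest increments is a real lift of the walk: it projects back to the position
    on the circle. *)
Lemma circle_step_sum (R : realType) (u : nat -> string) m :
  exists k : int, pos_circ R (u m) = pos_circ R (u 0%N) +
    \sum_(0 <= i < m) circle_step R (u i) (u i.+1) + k%:~R.
Proof.
elim: m => [|m [k IH]]; first by exists 0; rewrite big_nil !addr0.
exists (k + Num.floor (pos_circ R (u m.+1) - pos_circ R (u m) + 2^-1)).
rewrite big_nat_recr //= /circle_step intrD.
move: (\sum_(_ <= _ < _) _) IH => s IH.
by move: (_%:~R) => f; rewrite IH; ring.
Qed.

Lemma exists_expr_lt (R : realType) (c e z : R) :
  0 <= z < 1 -> 0 < e -> exists n, c * z ^+ n < e.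
Proof.
move=> /andP[z0 z1] e0.
have z1' : `|z| < 1 by rewrite ger0_norm.
have : geometric c z n @[n --> \oo] --> (0 : R) by exact: cvg_geometric.
move=> /cvgrPdist_lt/(_ e e0)[n _ /(_ n (leqnn n))] /=.
by rewrite sub0r normrN => H; exists n; apply: le_lt_trans H; rewrite ler_norm.
Qed.

Lemma nbr_circ_gt0 w : (0 < size (nbr_circ w))%N.
Proof. by []. Qed.

Lemma nbr_plus_gt0 w : (0 < size (nbr_plus w))%N.
Proof. by []. Qed.

Lemma rho_bounds (R : realType) : (0 <= 79 / 80 :> R) * (79 / 80 < 1 :> R).
Proof. by split; lra. Qed.

(** The centre is the fixed position of [x n], which is that of [X n t] on the cylinder. *)
Definition stay (R : realType) (T : Type) (X : nat -> T -> string) n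
    (x : nat -> string) (eps : R) : set T :=
  cylinder X n x `&` [set t | forall m, (n <= m)%N ->
    circle_dist (pos_circ R (X m t)) (pos_circ R (x n)) < eps].

Lemma measurable_stay (R : realType) (d : measure_display) (T : measurableType d)
    (X : nat -> T -> string) n (x : nat -> string) (eps : R) :
  (forall n w, measurable [set t | X n t = w]) -> measurable (stay X n x eps).
Proof.
move=> mX; apply: measurableI; first exact: measurable_cylinder.
rewrite (_ : [set t | _] = \bigcap_(m in [set m | (n <= m)%N])
   X m @^-1` [set w | circle_dist (pos_circ R w) (pos_circ R (x n)) < eps]).
  by apply: bigcap_measurableType => m _; exact: measurable_preimage_discrete.
by apply/seteqP; split => t /= H m; apply: H.
Qed.

Lemma srw_stay_gt0 (R : realType) (d : measure_display) (T : measurableType d)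
    (P : probability T R) (X : nat -> T -> string) :
  is_srw nbr_circ [::] P X -> forall n (x : nat -> string) (eps : R),
  x 0%N = [::] -> (forall i, (i < n)%N -> x i.+1 \in nbr_circ (x i)) ->
  0 < eps ->
  (0 < P (stay X n x eps))%E.
Proof.
move=> srwX n x eps x0 adj eps0; have [mX _ _] := srwX.
(* [M] zeros are to be appended: 15 bounds the weight in [potential], and division by [1 - 79 / 80]
   sums the geometric series. *)
have [M HM] : exists M, 15 / (1 - 79 / 80) * (3 / 4 : R) ^+ M < eps.
  by apply: exists_expr_lt => //; lra.
(* [y] follows [x] up to time [n] and then only appends zeros, so its position no longer changes. *)
pose y i := if (i <= n)%N then x i else x n ++ nseq (i - n) false.
pose N := (n + M)%N.
have yn i : (n <= i)%N -> y i = x n ++ nseq (i - n) false.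
  rewrite /y leq_eqVlt => /predU1P[<-|]; last by rewrite ltnNge => /negbTE ->.
  by rewrite leqnn subnn cats0.
have Py : (0 < P (cylinder X N y))%E.
  apply: (srw_cylinder_gt0 srwX) => // i iN.
  have [lt|ge] := ltnP i n; first by rewrite /y lt (ltnW lt) adj.
  rewrite !yn ?(leqW ge) // subSn // -addn1 nseqD catA cats1.
  by rewrite /nbr_circ !inE eqxx !orbT.
have gy : potential R (y N) / (1 - 79 / 80) < eps.
  apply: le_lt_trans HM; rewrite [leRHS]mulrAC ler_pM2r; last by rewrite invr_gt0; lra.
  apply: le_trans (potential_le R _) _; apply: ler_wpM2l => //.
  apply: ler_wiXn2l; [by lra|by lra|].
  by rewrite yn ?leq_addr // size_cat size_nseq /N; lia.
have [r0 r1] := rho_bounds R.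
have := @srw_small_variation _ _ _ _ _ _ _ _ _ _ (circle_step R) srwX
  nbr_circ_gt0 r0 r1 (@potential_superharmonic_circ R) (@circle_step_le R)
  N y eps Py gy.
set B := _ `&` _ => PB; apply: (lt_le_trans PB).
have mcyl k z : measurable (cylinder X k z) by exact: measurable_cylinder.
have mvar : measurable_fun [set: T] (variation X (circle_step R) N).
  exact: (measurable_variation (circle_step R) srwX N).
apply: le_measure; rewrite ?inE.
- apply: measurableI => //.
  rewrite -[X in measurable X]setTI; apply: emeasurable_fun_infty_o => //.
- exact: measurable_stay.
move=> t [cyl /= var]; split => [i iN|m nm].
  by rewrite cyl ?(leq_trans iN) ?leq_addr // /y iN.
have posy i : (n <= i)%N -> pos_circ R (y i) = pos_circ R (x n).
  by move=> ni; rewrite yn // pos_circ_cat_nseq0.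
(* Up to time [N] the position is exactly that of [x n]; afterwards the displacement of the lift is
   at most the variation from time [N]. *)
have [mN|/ltnW Nm] := leqP m N.
  rewrite cyl // posy //; apply/circle_dist_ltP; exists 0.
  by rewrite subrr addr0 normr0.
have [k] := circle_step_sum R (fun i => X (N + i)%N t) (m - N).
rewrite subnKC // addn0 [X N t]cyl // posy ?leq_addr // => ->.
apply/circle_dist_ltP; exists (- k).
rewrite rmorphN /= (_ : _ + _ = \sum_(0 <= i < m - N)
  circle_step R (X (N + i)%N t) (X (N + i.+1)%N t)); last by ring.
apply: (le_lt_trans (ler_norm_sum _ _ _)); rewrite -lte_fin.
apply: le_lt_trans var; under eq_bigr do rewrite addnS.
exact: le_variation.
Qed.

(** * Existence of the limits *)

Lemma circ_limit_exists (R : realType) (d : measure_display)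
    (T : measurableType d) (P : probability T R) (X : nat -> T -> string) :
  is_srw nbr_circ [::] P X -> exists L : {RV P >-> R}, circ_limit X L.
Proof.
move=> srwX; have [r0 r1] := rho_bounds R.
have [S limS] := srw_limit srwX nbr_circ_gt0 r0 r1
  (@potential_superharmonic_circ R) (@circle_step_le R) (pos_circ R).
(* The lifted walk converges to [S]; its fractional part is the limit on the circle. *)
have mL : measurable_fun [set: T] (fun t => S t - (Num.floor (S t))%:~R).
  exact: (measurableT_comp (@measurable_frac R)).
exists (mfun_Sub (mem_set mL)); split => [t|].
  rewrite /circle /=; have /andP[] := floor_itv (S t).
  by rewrite intrD => lo hi; apply/andP; split; lra.
apply: filterS limS => t cvS.
have := cvS => /cvgrPdist_lt cvS'.
apply/cvgrPdist_lt => e e0; near=> n.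
rewrite sub0r normrN ger0_norm ?circle_dist_ge0 //=.
apply/circle_dist_ltP.
have [k ->] := circle_step_sum R (fun i => X i t) n.
(* This integer cancels both the discrepancy of the lift and the integer part of [S]. *)
exists (- k - Num.floor (S t)); rewrite rmorphB rmorphN /=.
rewrite (_ : _ + _ = - (S t - (pos_circ R (X 0%N t) +
  \sum_(0 <= i < n) circle_step R (X i t) (X i.+1 t)))); last by ring.
by rewrite normrN; near: n; exact: cvS'.
Unshelve. all: by end_near. Qed.

Lemma plus_limit_exists (R : realType) (d : measure_display)
    (T : measurableType d) (P : probability T R) (Y : nat -> T -> int * string) :
  is_srw nbr_plus (0, [::]) P Y -> exists L : {RV P >-> R}, plus_limit Y L.
Proof.
move=> srwY; have [r0 r1] := rho_bounds R.
have Dle u v : v \in nbr_plus u ->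
    `|pos_plus R v - pos_plus R u| <= potential R u.2.
  by move=> /(nbr_plus_dist R) /le_trans; apply; exact: potential_ge.
have [L limL] := srw_limit srwY nbr_plus_gt0 r0 r1
  (@potential_superharmonic_plus R) Dle (pos_plus R).
exists L; apply: filterS limL => t.
rewrite (_ : (fun n => _) = fun n => pos_plus R (Y n t)) //; apply/funext => n.
by rewrite telescope_sumr // addrC subrK.
Qed.

(** * Density of reachable positions and the support *)

Definition reachable (w : string) :=
  exists2 s, path (adjacent nbr_circ) [::] s & last [::] s = w.

Lemma reachable_step w v : reachable w -> v \in nbr_circ w -> reachable v.
Proof.
by move=> [s ps <-] vw; exists (rcons s v); rewrite ?last_rcons // rcons_path ps.
Qed.

Lemma string_of0 n : string_of n 0 = nseq n false.
Proof.
apply: (@eq_from_nth _ false); rewrite size_string_of ?size_nseq // => i iN.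
by rewrite nth_mkseq // div0n nth_nseq iN.
Qed.

(** Append [m] zeros to the empty string, then add 1 [j] times at depth [m]; as [j < 2 ^ m], no
    wrap-around occurs. *)
Lemma reachable_string_of m j : (j < 2 ^ m)%N -> reachable (string_of m j).
Proof.
elim: j => [_|j IH jm].
  rewrite string_of0; elim: m => [|m IH]; first by exists [::].
  apply: (reachable_step IH); rewrite -addn1 nseqD cats1.
  by rewrite /nbr_circ !inE eqxx !orbT.
apply: (reachable_step (IH (ltnW jm))).
rewrite (_ : string_of m j.+1 = string_add 1 (string_of m j)) ?mem_head //.
rewrite /string_add size_string_of string_val_of modn_small ?(ltnW jm) //.
by rewrite -PoszD addn1 modz_nat absz_nat modn_small.
Qed.

Lemma dense_reachable (R : realType) (x e : R) : circle R x -> 0 < e ->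
  exists2 w, reachable w & circle_dist x (pos_circ R w) < e.
Proof.
move=> /andP[x0 x1] e0.
have [m] : exists m, 1 * (2^-1 : R) ^+ m < e by apply: exists_expr_lt => //; lra.
rewrite mul1r => me.
have N0 : (0 : R) < 2 ^+ m by rewrite exprn_gt0.
(* Truncating [x] to [m] binary digits gives an error of at most [2 ^- m]. *)
have /andP[lo hi] := floor_itv (x * 2 ^+ m).
have fl0 : 0 <= Num.floor (x * 2 ^+ m) by rewrite floor_ge0 mulr_ge0 // ltW.
move: lo hi fl0; case: (Num.floor _) => // j; rewrite -PoszD -!pmulrn => lo hi _.
have jm : (j < 2 ^ m)%N.
  rewrite -(ltr_nat R) natrX; apply: le_lt_trans lo _.
  by rewrite gtr_pMl.
exists (string_of m j); first exact: reachable_string_of.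
apply/circle_dist_ltP; exists 0; rewrite addr0.
rewrite pos_circE string_val_of modn_small // size_string_of.
apply: le_lt_trans me; rewrite exprVn.
rewrite -(@ler_pM2r _ (2 ^+ m)) // mulVf ?gt_eqF // -{2}(gtr0_norm N0) -normrM.
rewrite mulrBl divfK ?gt_eqF // ger0_norm ?subr_ge0 //.
by move: hi; rewrite natrD lerBlDl => /ltW.
Qed.

Lemma nth_path_adjacent (s : seq string) : path (adjacent nbr_circ) [::] s ->
  forall i, (i < size s)%N ->
  nth [::] ([::] :: s) i.+1 \in nbr_circ (nth [::] ([::] :: s) i).
Proof. by move=> /(pathP [::]) H i /H. Qed.

Lemma circle_dist_triangle (R : realType) (x y z a b : R) :
  circle_dist x y < a -> circle_dist y z < b -> circle_dist x z < a + b.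
Proof.
move=> /circle_dist_ltP[k ka] /circle_dist_ltP[l lb]; apply/circle_dist_ltP.
exists (k + l); rewrite intrD.
rewrite (_ : _ + _ = x - y + k%:~R + (y - z + l%:~R)); last by ring.
by apply: le_lt_trans (ler_normD _ _) _; exact: ltrD.
Qed.

Lemma circle_distC (R : realType) (x y : R) : circle_dist x y = circle_dist y x.
Proof.
have le u v : circle_dist u v <= circle_dist v u :> R.
  apply/ler_addgt0Pr => e e0.
  have : circle_dist v u < circle_dist v u + e by rewrite ltrDl.
  move=> /circle_dist_ltP[k /ltW]; apply: le_trans.
  rewrite -normrN opprD opprB -rmorphN; exact: circle_dist_le.
by apply/le_anti; rewrite !le.
Qed.

Lemma circle_support_harmonic (R : realType) (nu : set R -> \bar R) :
  is_harmonic_circ nu -> circle_support nu = circle R.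
Proof.
move=> [d [T [P [X [L [srwX [Lcirc Llim] ->]]]]]].
apply/seteqP; split => [x []//|x xc]; split=> // e e0.
(* One third each for the distance from [x] to a reachable position, for the later fluctuation of
   the walk, and for its distance to the limit. *)
have e30 : 0 < e / 3 by lra.
have [_ [s ps <-] xw] := dense_reachable xc e30.
have := srw_stay_gt0 srwX (erefl : nth [::] ([::] :: s) 0 = [::])
  (nth_path_adjacent ps) e30.
set F := stay _ _ _ _ => PF; have [mX _ _] := srwX.
set Bl := circle R `&` _.
have mBl : measurable Bl.
  by apply: measurableI; [exact: measurable_circle|exact: measurable_circle_ball].
have mF : measurable F by exact: measurable_stay.
have mLBl : measurable (L @^-1` Bl).
  by rewrite -[X in measurable X]setTI; exact: (measurable_funPT L).
have [A [mA PA0 nA]] := Llim.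
(* Outside the null set [A] of divergent trajectories, staying near the reachable position forces
   the limit into the ball around [x]. *)
have FA : F `<=` A `|` L @^-1` Bl.
  move=> t [_ st]; have [At|nAt] := pselect (A t); [by left|right].
  split; first exact: Lcirc.
  have : circle_dist (pos_circ R (X n t)) (L t) @[n --> \oo] --> (0 : R).
    by apply: contrapT => nt; apply: nAt; exact: nA.
  move=> /cvgrPdist_lt/(_ _ e30)[k _ Hk].
  pose m := maxn k (size s).
  have := Hk m (leq_maxl _ _); rewrite /= sub0r normrN ger0_norm ?circle_dist_ge0 //.
  have := st m (leq_maxr _ _); rewrite circle_distC -last_nth => wX XL.
  have := circle_dist_triangle (circle_dist_triangle xw wX) XL.
  by rewrite (_ : _ + _ + _ = e) //; lra.
apply: (lt_le_trans PF).
apply: (le_trans (le_measure P _ _ FA)); rewrite ?inE //; first exact: measurableU.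
have PA : P A = 0%E by exact: PA0.
have PU : (P (A `|` L @^-1` Bl) <= P A + P (L @^-1` Bl))%E by exact: measureU2.
by apply: (le_trans PU); rewrite PA add0e.
Qed.

Theorem proposition3p7 (R : realType) :
  (forall (d : measure_display) (T : measurableType d) (P : probability T R)
      (X : nat -> T -> string),
    is_srw nbr_circ [::] P X -> exists L : {RV P >-> R}, circ_limit X L) /\
  (forall (d : measure_display) (T : measurableType d) (P : probability T R)
      (Y : nat -> T -> int * string),
    is_srw nbr_plus (0, [::]) P Y -> exists L : {RV P >-> R}, plus_limit Y L) /\
  (forall nu : set R -> \bar R, is_harmonic_circ nu ->
    circle_support nu = circle R) /\
  (forall (d : measure_display) (T : measurableType d) (P : probability T R)
      (X : nat -> T -> string),
    is_srw nbr_circ [::] P X ->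
    forall (xs : seq string) (eps : R),
      path (adjacent nbr_circ) [::] xs -> 0 < eps ->
      (0 < P [set t |
        (forall i, (i <= size xs)%N -> X i t = nth [::] ([::] :: xs) i) /\
        (forall n, (size xs <= n)%N ->
           (circle_dist (pos_circ R (X n t)) (pos_circ R (X (size xs) t)) < eps)%R)])%E).
Proof.
split; first exact: circ_limit_exists.
split; first exact: plus_limit_exists.
split; first exact: circle_support_harmonic.
move=> d T P X srwX xs eps pxs eps0.
have := srw_stay_gt0 srwX (erefl : nth [::] ([::] :: xs) 0 = [::])
  (nth_path_adjacent pxs) eps0.
(* On the cylinder [X (size xs) t] is the end of the path, so the event in the statement coincides
   with [stay]. *)
congr (_ < P _)%E; apply/seteqP; split => t /= [cyl stay]; split => // n nn.
  by rewrite (cyl (size xs)) //; exact: stay.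
by rewrite -(cyl (size xs)) //; exact: stay.
Qed.
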